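(* Let $I\subset R=\mathbf{k}[x_1,\dots,x_n]$ be an artinian monomial ideal, and let $\mathcal{B}_{n-1}(I)$ be the set of multidegrees $\nu\in\mathbb{N}^n$ such that $H_{n-1,\nu}(\mathbb{K}(I))\neq 0$. Then the irredundant irreducible decomposition of $I$ is $$I=\bigcap_{\nu\in\mathcal{B}_{n-1}(I)}\mathfrak{m}^{\nu}.$$
   Context: $\mathbf{k}$ is a field of characteristic $0$, $R=\mathbf{k}[x_1,\dots,x_n]$ with its $\mathbb{N}^n$-grading. A monomial ideal $I$ is artinian if $R/I$ is zero-dimensional (equivalently, for every $i$ a power $x_i^{a_i}$, $a_i>0$, is a minimal generator of $I$). For $\nu\in\mathbb{N}^n$, $\mathfrak{m}^{\nu}=\langle x_i^{\nu_i}\mid \nu_i>0\rangle$. An irreducible decomposition of a monomial ideal $I$ is an expression $I=\mathfrak{m}^{a_1}\cap\cdots\cap\mathfrak{m}^{a_s}$; it is irredundant if no intersectand can be omitted. The irredundant irreducible decomposition of a monomial ideal is unique. Koszul homology: let $\mathcal{V}$ be the $\mathbf{k}$-vector space with basis $x_1,\dots,x_n$. $\mathbb{K}(I)$ is the complex with modules $I\otimes_{\mathbf{k}}\wedge^i\mathcal{V}$ in homological degree $i$ and differential $\partial(m\otimes x_{j_1}\wedge\cdots\wedge x_{j_i})=\sum_{l=1}^i(-1)^{l+1}x_{j_l}m\otimes x_{j_1}\wedge\cdots\wedge\widehat{x_{j_l}}\wedge\cdots\wedge x_{j_i}$. It is $\mathbb{N}^n$-graded (the multidegree of $x^\mu\otimes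 x_{j_1}\wedge\cdots\wedge x_{j_i}$ is $\mu+e_{j_1}+\cdots+e_{j_i}$), and $H_{i,\nu}(\mathbb{K}(I))\cong \mathrm{Tor}^R_{i,\nu}(I,\mathbf{k})$ is the multidegree-$\nu$ part of its $i$-th homology. *)

(* Defs.v *)
(* MathComp world: multivariate polynomials from multinomials, Prop-valued
   subsets from mathcomp-classical. *)
From HB Require Import structures.
From mathcomp Require Import all_boot all_order all_algebra.
From mathcomp Require Import mpoly.
From mathcomp Require Import boolp classical_sets functions cardinality.

Set Implicit Arguments.
Unset Strict Implicit.
Unset Printing Implicit Defensive.

Import GRing.Theory.
Local Open Scope ring_scope.

Section Ideals.
Variable A : comNzRingType.
Local Open Scope classical_set_scope.

(* The unit ideal is allowed. *)
Definition is_ideal (I : set A) : Prop :=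
  [/\ I 0, forall p q, I p -> I q -> I (p + q) & forall r p, I p -> I (r * p)].

Definition ideal_gen (S : set A) : set A := smallest is_ideal S.

Definition is_prime_ideal (P : set A) : Prop :=
  [/\ is_ideal P, ~ P 1 & forall a b, P (a * b) -> P a \/ P b].

(* Krull dimension of the quotient A/I equal to 0: its primes are the primes of
   A containing I; there is at least one, and none strictly contains another.
   In particular I is a proper ideal. *)
Definition zero_dimensional_quotient (I : set A) : Prop :=
  (exists2 P : set A, is_prime_ideal P & I `<=` P) /\
  (forall P Q : set A, is_prime_ideal P -> is_prime_ideal Q ->
     I `<=` P -> P `<=` Q -> P = Q).

End Ideals.

Section MonomialIdeals.
Variables (k : fieldType) (n : nat).
Local Notation R := {mpoly k[n]}.
Local Open Scope classical_set_scope.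

Definition is_monomial_ideal (I : set R) : Prop :=
  exists M : set 'X_{1..n}, I = ideal_gen [set 'X_[m] | m in M].

Definition artinian_monomial_ideal (I : set R) : Prop :=
  is_monomial_ideal I /\ zero_dimensional_quotient I.

(* The ideal m^nu; it is the zero ideal when nu = 0. *)
Definition irreducible_monomial_ideal (nu : 'X_{1..n}) : set R :=
  ideal_gen [set 'X_i ^+ nu i | i in [set i : 'I_n | (0 < nu i)%N]].

(* The exponents of a decomposition are collected in a finite set; in an
   irredundant decomposition repetitions are excluded anyway. *)
Definition is_irreducible_decomposition (I : set R) (E : set 'X_{1..n}) : Prop :=
  finite_set E /\ I = \bigcap_(nu in E) irreducible_monomial_ideal nu.

Definition is_irredundant_irreducible_decomposition
    (I : set R) (E : set 'X_{1..n}) : Prop :=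
  is_irreducible_decomposition I E /\
  (forall nu, E nu ->
     \bigcap_(mu in E `\ nu) irreducible_monomial_ideal mu <> I).

End MonomialIdeals.

Section Koszul.
Variables (k : fieldType) (n : nat).
Local Notation R := {mpoly k[n]}.

(* An element \sum_J c_J (x) x_J of R (x) /\V is encoded by its coefficients
   c_J on the standard basis x_J = x_{j_1} /\ ... /\ x_{j_i} of the exterior
   algebra, J = {j_1 < ... < j_i}; homological degree i means that c_J = 0
   unless #|J| = i. *)
Definition koszul_chain := {ffun {set 'I_n} -> R}.

(* p (x) x_J *)
Definition koszul_elt (p : R) (J : {set 'I_n}) : koszul_chain :=
  [ffun L => if L == J then p else 0].

(* If j = j_l, then #|[set l in J | l < j]| = l - 1, so the sign is
   (-1)^(l+1). *)
Definition koszul_diff (c : koszul_chain) : koszul_chain :=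
  \sum_(J : {set 'I_n}) \sum_(j in J)
    koszul_elt ((-1) ^+ #|[set l in J | (l < j)%N]| * 'X_j * c J) (J :\ j)%SET.

Definition koszul_module (I : set R) (i : nat) (c : koszul_chain) : Prop :=
  forall J : {set 'I_n}, I (c J) /\ (#|J| != i -> c J = 0).

Definition has_multidegree (nu : 'X_{1..n}) (c : koszul_chain) : Prop :=
  forall (J : {set 'I_n}) (mu : 'X_{1..n}),
    mu \in msupp (c J) -> (mu + \sum_(j in J) U_(j))%MM = nu.

Definition koszul_strand (I : set R) (i : nat) (nu : 'X_{1..n})
    : set koszul_chain :=
  [set c | koszul_module I i c /\ has_multidegree nu c]%classic.

Definition koszul_cycles (I : set R) (i : nat) (nu : 'X_{1..n})
    : set koszul_chain :=
  [set z | koszul_strand I i nu z /\ koszul_diff z = 0]%classic.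

Definition koszul_boundaries (I : set R) (i : nat) (nu : 'X_{1..n})
    : set koszul_chain :=
  [set koszul_diff w | w in koszul_strand I i.+1 nu]%classic.

(* H_{i,nu}(K(I)) = cycles / boundaries is nonzero. *)
Definition koszul_homology_neq0 (I : set R) (i : nat) (nu : 'X_{1..n}) : Prop :=
  ~ (koszul_cycles I i nu `<=` koszul_boundaries I i nu)%classic.

(* The set B_i(I) *)
Definition koszul_multidegrees (I : set R) (i : nat) : set 'X_{1..n} :=
  [set nu | koszul_homology_neq0 I i nu]%classic.

End Koszul.

(* Main.v *)
Require Import Defs.
From mathcomp Require Import all_boot all_order all_algebra.
From mathcomp Require Import ring mpoly.
From mathcomp Require Import boolp classical_sets functions cardinality.

(** Put 1 = (1,...,1) and let S be the set of socle monomials of R/I: the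
x^m outside I all of whose multiples x_i x^m lie in I.  The proof shows that
both sides of the decomposition are governed by S, through nu = m + 1.

Homology.  In multidegree nu a Koszul chain of degree n - 1 has one scalar
multiple of x^(nu - 1 + e_i) for each facet [n] \ {i}, and a chain of degree n
is a scalar multiple of x^(nu - 1) on [n].  After a sign normalization y_i of
the facet coefficients, the differential of a top chain p has y_i = x_i p, and
a chain of degree n - 1 is a cycle iff x_j y_i = x_i y_j for all i, j
([koszul_diff_eq0]).  A nonzero cycle of multidegree nu therefore has all y_i
nonzero, with a common scalar c; this forces nu >= 1 (when n = 1, because 1 is
not in I), and the cycle equals the differential of c x^(nu - 1);
its coefficients lie in I iff all x^(nu - 1 + e_i) do, and it bounds inside I
iff x^(nu - 1) does.  So homology in multidegree nu is nonzero iff nu >= 1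
and x^(nu - 1) is a socle monomial ([koszul_multidegrees_socle]).

Decomposition.  A monomial x^mu lies in m^(m + 1) iff mu is not below m.
Since only finitely many monomials are outside I, each of them divides a socle
monomial, and so I is the intersection of the m^(m + 1), x^m in S.  Socle
monomials are pairwise incomparable, so x^m lies in all the other components:
none can be omitted ([socle_irredundant_decomposition]).

Finiteness comes from [artinian_pure_power]: if no power of x_i were in I,
then I would lie in the prime (x_j, j <> i), which is strictly contained in the
prime generated by all the variables. *)

Set Implicit Arguments.
Unset Strict Implicit.
Unset Printing Implicit Defensive.

(** * Ideals *)

Section Ideals.
Variable A : comNzRingType.
Local Open Scope ring_scope.
Local Open Scope classical_set_scope.
Import GRing.Theory.

Lemma ideal_gen_is_ideal (S : set A) : is_ideal (ideal_gen S).
Proof.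
split=> [|p q Ip Iq|r p Ip] J [idJ SJ]; have [J0 JD JM] := idJ.
- by [].
- by apply: JD; [apply: Ip|apply: Iq].
- by apply: JM; apply: Ip.
Qed.

Lemma ideal_sum (I : set A) (T : eqType) (s : seq T) (F : T -> A) :
  is_ideal I -> (forall t, t \in s -> I (F t)) -> I (\sum_(t <- s) F t).
Proof.
move=> [I0 ID _] IF; rewrite big_seq.
by apply: big_ind => // t /IF.
Qed.

Lemma kernel_is_prime_ideal (B : idomainType) (f : {rmorphism A -> B}) :
  is_prime_ideal [set p | f p = 0].
Proof.
split=> [|/=|a b /=].
- split=> [|p q /= fp fq|r p /= fp] /=.
  + exact: rmorph0.
  + by rewrite rmorphD fp fq addr0.
  + by rewrite rmorphM fp mulr0.
- by rewrite rmorph1; apply/eqP/oner_neq0.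
- by rewrite rmorphM => /eqP; rewrite mulf_eq0 => /orP[]/eqP; [left|right].
Qed.

End Ideals.

(** * Monomial ideals and their socle monomials *)

Section MonomialIdeals.
Context {k : fieldType} {n : nat}.
Local Notation R := {mpoly k[n]}.
Implicit Types (I : set R) (m mu nu : 'X_{1..n}).
Local Open Scope ring_scope.
Local Open Scope classical_set_scope.
Import GRing.Theory.

(** The polynomials satisfying the right-hand side form an ideal because the
support of a sum or product only involves monomials from the supports of the
operands, or their products. *)
Lemma mem_gen_monomials (M : set 'X_{1..n}) (p : R) :
  ideal_gen [set 'X_[m] | m in M] p <->
  forall mu, mu \in msupp p -> exists2 m, M m & (m <= mu)%MM.
Proof.
pose J := [set p : R | forall mu, mu \in msupp p ->
                         exists2 m, M m & (m <= mu)%MM].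
split; last first.
  have [_ _ genM] := @ideal_gen_is_ideal R [set 'X_[m] | m in M].
  move=> pM; rewrite [p]mpolyE; apply: ideal_sum (@ideal_gen_is_ideal _ _) _.
  move=> mu /pM[m Mm le_m]; rewrite -(submK le_m) mpolyXD scalerAl.
  by apply: genM => K [_]; apply; exists m.
suff: ideal_gen [set 'X_[m] | m in M] `<=` J by apply.
apply: smallest_sub => [|_ [m Mm <-] mu]; last first.
  by rewrite msuppX inE => /eqP->; exists m => //; exact: lepm_refl.
split=> [mu|p1 p2 J1 J2 mu /msuppD_le|r p1 J1 mu /msuppM_le].
- by rewrite msupp0.
- by rewrite mem_cat => /orP[/J1|/J2].
- case/allpairsP=> -[m1 m2] [/= _ /J1[m Mm le_m] ->].
  by exists m => //; apply: lepm_trans le_m (lem_addl _ _).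
Qed.

(** Reduces every question about a monomial ideal to the monomials in it. *)
Lemma monomial_idealP I (p : R) : is_monomial_ideal I ->
  I p <-> forall mu, mu \in msupp p -> I 'X_[mu].
Proof.
case=> M ->; rewrite mem_gen_monomials; split=> Mp mu.
- move=> /Mp Mmu; apply/mem_gen_monomials=> nu.
  by rewrite msuppX inE => /eqP->.
- move=> /Mp /mem_gen_monomials; apply.
  by rewrite msuppX inE.
Qed.

Lemma monomial_ideal_is_ideal I : is_monomial_ideal I -> is_ideal I.
Proof. by case=> M ->; exact: ideal_gen_is_ideal. Qed.

Lemma ideal_monomial_le {I m mu} :
  is_ideal I -> (m <= mu)%MM -> I 'X_[m] -> I 'X_[mu].
Proof. by move=> [_ _ IM] le_m Im; rewrite -(submK le_m) mpolyXD; apply: IM. Qed.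

Lemma mem_irreducible_monomial_ideal nu (p : R) :
  irreducible_monomial_ideal nu p <->
  forall mu, mu \in msupp p -> exists2 i, (0 < nu i)%N & (nu i <= mu i)%N.
Proof.
pose M := [set (U_(i) *+ nu i)%MM | i in [set i : 'I_n | (0 < nu i)%N]].
have leM i mu : (U_(i) *+ nu i <= mu)%MM = (nu i <= mu i)%N.
  apply/mnm_lepP/idP => [/(_ i)|le_i j]; first by rewrite mulmnE mnm1E eqxx mul1n.
  by rewrite mulmnE mnm1E; case: eqP => [<-|_]; rewrite ?mul1n ?mul0n.
rewrite /irreducible_monomial_ideal.
rewrite (_ : [set 'X_i ^+ nu i | i in _] = [set ('X_[m] : R) | m in M]); last first.
  rewrite /M image_comp; apply: eq_imagel => i _ /=.
  by rewrite mpolyXn.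
rewrite mem_gen_monomials; split=> Mp mu /Mp.
- by case=> _ [i nui <-]; rewrite leM => ?; exists i.
- by case=> i nui le_i; exists (U_(i) *+ nu i)%MM; [exists i|rewrite leM].
Qed.

Definition mnm_one : 'X_{1..n} := (\sum_(i in [set: 'I_n]%SET) U_(i))%MM.

Lemma mnm_oneE i : mnm_one i = 1%N.
Proof.
rewrite mnm_sumE (bigD1 i) ?inE //= mnm1E eqxx big1 // => j /andP[_ ji].
by rewrite mnm1E (negPf ji).
Qed.

(** The complement of m^(m + 1) among monomials is the box of the divisors of
x^m; this is what links irreducible components to socle monomials. *)
Lemma mem_irreducible_succ m (p : R) :
  irreducible_monomial_ideal (m + mnm_one)%MM p <->
  forall mu, mu \in msupp p -> ~~ (mu <= m)%MM.
Proof.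
rewrite mem_irreducible_monomial_ideal; split=> mp mu /mp.
- case=> i _; rewrite mnmDE mnm_oneE addn1 => lt_i.
  by apply/negP => /mnm_lepP/(_ i); rewrite leqNgt lt_i.
- move=> Nle; have /existsP[i] : [exists i, (m i < mu i)%N].
    apply: contraR Nle; rewrite negb_exists => /forallP le_mu.
    by apply/mnm_lepP => i; rewrite leqNgt.
  by exists i; rewrite mnmDE mnm_oneE addn1.
Qed.

Definition socle_monomials I : set 'X_{1..n} :=
  [set m | ~ I 'X_[m] /\ forall i, I 'X_[m + U_(i)]].

(** If mu were larger than m at some i, then x_i x^m, which is in I, would
divide x^mu. *)
Lemma socle_monomial_maximal I m mu : is_ideal I -> socle_monomials I m ->
  ~ I 'X_[mu] -> (m <= mu)%MM -> mu = m.
Proof.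
move=> idI [_ Im] Imu le_m; apply/mnmP => i; apply/eqP; rewrite eqn_leq.
rewrite (mnm_lepP le_m) andbT leqNgt; apply/negP => lt_i.
apply: Imu; apply: ideal_monomial_le idI _ (Im i).
apply/mnm_lepP => j; rewrite mnmDE mnm1E.
by case: eqP => [<-|_]; rewrite ?addn1 // addn0 (mnm_lepP le_m).
Qed.

(** Multiply by variables as long as the product stays outside I; the degree
bound makes this stop, at a socle monomial. *)
Lemma below_socle_monomial I N mu : is_ideal I ->
  (forall m, ~ I 'X_[m] -> (mdeg m < N)%N) -> ~ I 'X_[mu] ->
  exists2 m, socle_monomials I m & (mu <= m)%MM.
Proof.
move=> idI bnd; have [d] := ubnP (N - mdeg mu); elim: d mu => // d IHd mu.
move=> ltd Imu; have [soc|Nsoc] := pselect (forall i, I 'X_[mu + U_(i)]).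
  by exists mu => //; exact: lepm_refl.
have [i Ii] : exists i, ~ I 'X_[mu + U_(i)] by apply/existsNP.
have mdegS : mdeg (mu + U_(i)) = (mdeg mu).+1 by rewrite mdegD mdeg1 addn1.
have [|//|m soc_m le_m] := IHd (mu + U_(i))%MM.
  have := bnd _ Ii; rewrite mdegS => ltN.
  by rewrite -ltnS (leq_trans _ ltd) // ltnS subnSK // (leq_trans _ ltN).
by exists m => //; apply: lepm_trans le_m; exact: lem_addr.
Qed.

Proposition socle_irredundant_decomposition I N : is_monomial_ideal I ->
  (forall m, ~ I 'X_[m] -> (mdeg m < N)%N) ->
  is_irredundant_irreducible_decomposition I
    [set (m + mnm_one)%MM | m in socle_monomials I].
Proof.
move=> monI bnd; have idI := monomial_ideal_is_ideal monI.
split; [split|].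
- apply: finite_image; pose B : set 'X_{1..n} := range (@bmnm n N).
  have finB : finite_set B by apply/finite_image/finite_finset.
  by apply: sub_finite_set finB => m [/bnd ltN _]; exists (BMultinom ltN).
- apply/seteqP; split=> p.
  + move=> Ip _ [m [Im _] <-]; apply/mem_irreducible_succ => mu mu_p.
    apply/negP => le_mu; apply/Im/(ideal_monomial_le idI le_mu).
    by move/(monomial_idealP _ monI): Ip; apply.
  + move=> capp; apply/(monomial_idealP _ monI) => mu mu_p.
    apply: contrapT => /(below_socle_monomial idI bnd)[m soc_m le_mu].
    have /mem_irreducible_succ/(_ mu mu_p) : irreducible_monomial_ideal
      (m + mnm_one)%MM p by apply: capp; exists m.
    by rewrite le_mu.
(* The component attached to m is the only one that excludes x^m. *)
- move=> _ [m soc_m <-] capI; have [Im _] := soc_m; apply: Im.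
  rewrite -capI => _ [[m' soc_m' <-] /= neq]; apply/mem_irreducible_succ => mu.
  rewrite msuppX inE => /eqP->; apply/negP => le_m; apply: neq.
  by rewrite (socle_monomial_maximal idI soc_m _ le_m) //; case: soc_m'.
Qed.

Lemma artinian_one_notin I : artinian_monomial_ideal I -> ~ I 1.
Proof. by move=> [_ [[P [_ P1 _] IP] _]] /IP. Qed.

(** If I contains no power of x_i, each of its monomial generators involves a
variable other than x_i, so I is inside the kernel of f : x_j |-> 0 (j <> i),
x_i |-> X.  That kernel is a prime strictly contained in the prime of
polynomials without constant term, the kernel of g. *)
Lemma artinian_pure_power I i : artinian_monomial_ideal I ->
  exists a, I ('X_i ^+ a).
Proof.
move=> artI; have [[M defI] [_ minI]] := artI; apply: contrapT => NI.
have {}NI a : ~ I ('X_i ^+ a) by move=> ?; apply: NI; exists a.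
pose h j : {poly k} := if j == i then 'X else 0.
pose f : {rmorphism R -> {poly k}} := mmap (@polyC k) h.
pose g : {rmorphism R -> k} := horner_eval 0 \o f.
have MN0 m : M m -> exists2 j, j != i & (0 < m j)%N.
  move=> Mm; apply: contrapT => Nj; apply: (NI (m i)).
  rewrite defI mpolyXn => J [_]; apply; exists m => //; congr 'X_[_].
  apply/mnmP => j; rewrite mulmnE mnm1E eq_sym.
  have [->|ji] := eqVneq; first by rewrite mul1n.
  by apply/eqP; rewrite mul0n -leqn0 leqNgt; apply/negP => ?; apply: Nj; exists j.
have fX j : f 'X_j = h j by rewrite /f /= mmapX mmap1U.
have fg p : f p = 0 -> g p = 0 by rewrite /g /= => ->; rewrite rmorph0.
have : [set p | f p = 0] = [set p | g p = 0].
  apply: minI; [exact: kernel_is_prime_ideal|exact: kernel_is_prime_ideal| |].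
  - rewrite defI; apply: smallest_sub; first by case: (kernel_is_prime_ideal f).
    move=> _ [m /MN0[j ji mj] <-] /=.
    rewrite -[m](@submK _ U_(j)) ?mpolyXD; last first.
      by apply/mnm_lepP => l; rewrite mnm1E; case: eqP => // <-.
    by rewrite rmorphM fX /h (negPf ji) mulr0.
  - exact: fg.
move/seteqP=> [_ /(_ 'X_i)] /=; rewrite fX /h eqxx /horner_eval hornerX.
by move=> /(_ erefl)/eqP; rewrite polyX_eq0.
Qed.

Lemma artinian_mdeg_bound I : artinian_monomial_ideal I ->
  exists N, forall m, ~ I 'X_[m] -> (mdeg m < N)%N.
Proof.
move=> artI; have [/monomial_ideal_is_ideal idI _] := artI.
have /choice[a Ia] := fun i => artinian_pure_power i artI.
exists (\sum_i a i).+1 => m Im; rewrite ltnS mdegE leq_sum // => i _.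
rewrite leqNgt; apply/negP => /ltnW lt_i; apply/Im/(ideal_monomial_le idI _).
  2: by have := Ia i; rewrite mpolyXn; exact.
apply/mnm_lepP => j; rewrite mulmnE mnm1E.
by case: eqP => [<-|_]; rewrite ?mul1n ?mul0n.
Qed.

End MonomialIdeals.

(** * The Koszul complex in degrees n and n - 1 *)

Section Koszul.
Context {k : fieldType} {n : nat}.
Local Notation R := {mpoly k[n]}.
Local Notation chain := (koszul_chain k n).
Implicit Types (I : set R) (J L : {set 'I_n}) (c w z : chain) (m nu : 'X_{1..n}).
Local Open Scope ring_scope.
Import GRing.Theory.

Definition koszul_sign L (j : 'I_n) : R := (-1) ^+ #|[set l in L | (l < j)%N]|.

(** The sign may be computed in L as well as in j |: L, since j itself is not
below j. *)
Lemma koszul_diffE c L :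
  koszul_diff c L = \sum_(j | j \notin L) koszul_sign L j * 'X_j * c (j |: L)%SET.
Proof.
rewrite /koszul_diff sum_ffunE; under eq_bigr => J _ do rewrite sum_ffunE.
rewrite (exchange_big_dep xpredT) //= [RHS]big_mkcond; apply: eq_bigr => j _.
have [jL|jL] /= := boolP (j \in L).
  rewrite big1 // => J jJ; rewrite ffunE; case: eqP => // defL.
  by rewrite defL finset.setD11 in jL.
rewrite (bigD1 (j |: L)%SET) ?finset.setU11 //= big1 => [|J /andP[jJ neqJ]]; last first.
  rewrite ffunE; case: eqP => // defL.
  by rewrite defL finset.setD1K ?eqxx in neqJ.
rewrite ffunE finset.setU1K // eqxx addr0 /koszul_sign; congr (_ ^+ _ * _ * _).
apply: eq_card => l; rewrite !inE; case: (eqVneq l j) => [->|//].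
by rewrite ltnn !andbF.
Qed.

Lemma koszul_sign_setU1 L i j : i \notin L ->
  koszul_sign (i |: L)%SET j = (-1) ^+ (i < j)%N * koszul_sign L j.
Proof.
move=> iL; rewrite /koszul_sign -exprD; congr (_ ^+ _).
have [ij|ij] := boolP (i < j)%N.
  rewrite (cardsD1 i) !inE eqxx ij; congr (_ + _)%N; apply: eq_card => l.
  by rewrite !inE; case: eqVneq => [->|//]; rewrite (negPf iL).
rewrite add0n; apply: eq_card => l; rewrite !inE.
by case: eqVneq => [->|//]; rewrite (negPf ij) !andbF.
Qed.

Lemma koszul_sign_sqr L j : koszul_sign L j * koszul_sign L j = 1.
Proof. by rewrite -expr2 sqrr_sign. Qed.

Definition facet_sign (i : 'I_n) : R := koszul_sign [set~ i]%SET i.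
(** Up to this sign, the coefficient on the facet [n] \ {i}; the normalization
removes all signs from [koszul_diff_top] and from the cycle condition. *)
Definition facet_coef z (i : 'I_n) : R := facet_sign i * z [set~ i]%SET.

Lemma card_facet J : (0 < n)%N -> (#|J| == n.-1) = [exists i, J == [set~ i]%SET].
Proof.
move=> n_gt0; apply/eqP/existsP => [cJ|[i /eqP->]]; last by rewrite cardsC1 card_ord.
have /cards1P[i defJ] : #|~: J| == 1%N.
  by rewrite -(eqn_add2l #|J|) cardsC card_ord cJ addn1 prednK.
by exists i; rewrite -defJ finset.setCK.
Qed.

Lemma koszul_diff_top w i :
  facet_coef (koszul_diff w) i = 'X_i * w [set: 'I_n]%SET.
Proof.
rewrite /facet_coef koszul_diffE (big_pred1 i) => [|j]; last by rewrite !inE negbK.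
by rewrite finset.setUCr !mulrA koszul_sign_sqr mul1r.
Qed.

(** Only the facets missing i or j contribute at the complement L of {i, j}.
Inserting i into L changes the sign of j exactly when i < j, and inserting j
changes that of i exactly when j < i, so the two terms get opposite signs. *)
Lemma koszul_diff_setC2 z i j : i != j ->
  koszul_diff z (~: [set i; j])%SET =
  (-1) ^+ (i < j)%N * facet_sign i * facet_sign j *
    ('X_j * facet_coef z i - 'X_i * facet_coef z j).
Proof.
move=> neq_ij; set L := (~: [set i; j])%SET.
have iL : i \notin L by rewrite !inE eqxx.
have jL : j \notin L by rewrite !inE eqxx orbT.
have UiL : (i |: L)%SET = [set~ j]%SET.
  by apply/setP => l; rewrite !inE; case: eqVneq => [->|//]; rewrite neq_ij.
have UjL : (j |: L)%SET = [set~ i]%SET.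
  apply/setP => l; rewrite !inE; case: (eqVneq l j) => [->|]; rewrite ?orbF //.
  by rewrite eq_sym neq_ij.
have sgn_i : koszul_sign L i = (-1) ^+ (j < i)%N * facet_sign i.
  by rewrite /facet_sign -UjL koszul_sign_setU1 // mulrA -signr_addb addbb mul1r.
have sgn_j : koszul_sign L j = (-1) ^+ (i < j)%N * facet_sign j.
  by rewrite /facet_sign -UiL koszul_sign_setU1 // mulrA -signr_addb addbb mul1r.
rewrite koszul_diffE (bigD1 i) //= (big_pred1 j) => [|l]; last first.
  rewrite !inE negbK; case: (eqVneq l i) => [->|_]; last by rewrite andbT.
  by rewrite (negPf neq_ij).
rewrite UiL UjL sgn_i sgn_j /facet_coef.
have -> : (j < i)%N = ~~ (i < j)%N.
  by rewrite ltnNge leq_eqVlt -[_ == _ :> nat]/(i == j) (negPf neq_ij).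
(* Both normalizing signs a and b square to 1; the rest is a ring identity. *)
rewrite signrN; move: ((-1) ^+ (i < j)%N : R) => u.
have := koszul_sign_sqr [set~ i]%SET i; have := koszul_sign_sqr [set~ j]%SET j.
rewrite -/(facet_sign i) -/(facet_sign j).
move: (facet_sign i) (facet_sign j) ('X_i) ('X_j) (z _) (z _) => a b X Y p q bb aa.
have -> : u * a * b * (Y * (a * p) - X * (b * q)) =
  (u * (a * a) * b * Y * p) - u * a * (b * b) * X * q by ring.
by rewrite aa bb; ring.
Qed.

Lemma koszul_diff_degree w d L : (forall J, #|J| != d.+1 -> w J = 0) ->
  #|L| != d -> koszul_diff w L = 0.
Proof.
move=> w0 cL; rewrite koszul_diffE big1 // => j jL.
by rewrite w0 ?mulr0 // cardsU1 jL.
Qed.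

Lemma mem_msupp_sign L j (p : R) mu :
  (mu \in msupp (koszul_sign L j * p)) = (mu \in msupp p).
Proof.
rewrite /koszul_sign -signr_odd; case: odd; last by rewrite mul1r.
by rewrite mulN1r (perm_mem (msuppN p)).
Qed.

Lemma koszul_elt_setT_degree (p : R) J : (0 < n)%N ->
  #|J| != n.-1.+1 -> (koszul_elt p [set: 'I_n]%SET : chain) J = 0.
Proof.
move=> n_gt0; rewrite prednK // ffunE; case: (J =P _) => // ->.
by rewrite cardsT card_ord eqxx.
Qed.

Lemma facet_sign_neq0 i : facet_sign i != 0.
Proof. by rewrite /facet_sign /koszul_sign signr_eq0. Qed.

(** The cycle condition in degree n - 1: the vector of the y_i is proportional
to (x_1, ..., x_n) over the fraction field. *)
Lemma koszul_diff_eq0 z : (0 < n)%N -> (forall J, #|J| != n.-1 -> z J = 0) ->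
  koszul_diff z = 0 <->
  forall i j, 'X_j * facet_coef z i = 'X_i * facet_coef z j.
Proof.
move=> n_gt0 z0; split=> [dz0 i j|zC].
  have [->//|neq_ij] := eqVneq i j.
  have /eqP := koszul_diff_setC2 z neq_ij.
  rewrite dz0 ffunE eq_sym !mulf_eq0 signr_eq0 !(negPf (facet_sign_neq0 _)) /=.
  by rewrite subr_eq0 => /eqP.
apply/ffunP => L; rewrite [RHS]ffunE.
have [/existsP[i /existsP[j /andP[neq_ij /eqP->]]]|NL] :=
  boolP [exists i, exists j, (i != j) && (L == ~: [set i; j])%SET].
  by rewrite koszul_diff_setC2 // zC subrr mulr0.
rewrite koszul_diffE big1 // => j jL; rewrite z0 ?mulr0 //.
rewrite card_facet //; apply: contraNN NL => /existsP[i /eqP defL].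
apply/existsP; exists i; apply/existsP; exists j.
have -> : L = (~: [set i; j])%SET.
  rewrite -(finset.setU1K jL) defL; apply/setP => l; by rewrite !inE negb_or andbC.
rewrite eqxx andbT; apply: contraNneq jL => eq_ij.
by have := finset.setU11 j L; rewrite defL eq_ij !inE eqxx.
Qed.

Lemma mnm_one_setC1 i :
  (\sum_(j in [set~ i]%SET) U_(j) + U_(i))%MM = mnm_one :> 'X_{1..n}.
Proof.
rewrite /mnm_one [RHS](bigD1 i) ?inE //= addmC; congr (_ + _)%MM.
by apply: eq_bigl => j; rewrite !inE.
Qed.

(** The differential of x^m on [n] is a cycle with coefficients in I.  Its only
primitive is x^m on [n], because the top differential is injective, and x^m is
not in I. *)
Lemma socle_monomial_koszul I m : (0 < n)%N -> is_monomial_ideal I ->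
  socle_monomials I m -> koszul_homology_neq0 I n.-1 (m + mnm_one)%MM.
Proof.
move=> n_gt0 monI [Im socI] sub.
have [I0 _ IM] := monomial_ideal_is_ideal monI.
pose w : chain := koszul_elt 'X_[m] [set: 'I_n]%SET.
have w0 J : #|J| != n.-1.+1 -> w J = 0 by apply: koszul_elt_setT_degree.
have dw i : koszul_diff w [set~ i]%SET = facet_sign i * 'X_[m + U_(i)].
  apply: (mulfI (facet_sign_neq0 i)); rewrite mulrA koszul_sign_sqr mul1r.
  by rewrite -/(facet_coef _ i) koszul_diff_top mpolyXD mulrC ffunE eqxx.
case: (sub (koszul_diff w)) => [|v [modv degv] dv].
- split; last first.
    apply/(koszul_diff_eq0 n_gt0) => [J /(koszul_diff_degree w0)//|i j].
    by rewrite !koszul_diff_top mulrCA.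
  split=> [J|J mu].
  + split=> [|/(koszul_diff_degree w0)//].
    have [|/(koszul_diff_degree w0)->//] := boolP (#|J| == n.-1).
    by rewrite card_facet // => /existsP[i /eqP->]; rewrite dw; apply: IM.
  + have [|/(koszul_diff_degree w0)->] := boolP (#|J| == n.-1); last first.
      by rewrite msupp0.
    rewrite card_facet // => /existsP[i /eqP->]; rewrite dw.
    rewrite mem_msupp_sign msuppX inE => /eqP->.
    by rewrite -addmA (addmC U_(i)%MM) mnm_one_setC1.
- have := modv [set: 'I_n]%SET => -[Iv _]; apply: Im.
  suff <- : v [set: 'I_n]%SET = 'X_[m] by [].
  have X0 : 'X_(Ordinal n_gt0) != 0 :> R by rewrite -msupp_eq0 msuppX.
  apply: (mulfI X0).
  by rewrite -koszul_diff_top dv koszul_diff_top ffunE eqxx.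
Qed.

Lemma koszul_chain_eq c c' : (0 < n)%N ->
  (forall J, #|J| != n.-1 -> c J = 0) -> (forall J, #|J| != n.-1 -> c' J = 0) ->
  facet_coef c =1 facet_coef c' -> c = c'.
Proof.
move=> n_gt0 c0 c'0 eq_cc'; apply/ffunP => J.
have [|NJ] := boolP (#|J| == n.-1); last by rewrite c0 // c'0.
rewrite card_facet // => /existsP[i /eqP->].
exact: (mulfI (facet_sign_neq0 i)) (eq_cc' i).
Qed.

Lemma koszul_diff0 : koszul_diff 0 = 0 :> chain.
Proof.
apply/ffunP => L; rewrite koszul_diffE big1 ?ffunE // => j _.
by rewrite ffunE mulr0.
Qed.

(** A cycle which is not a boundary is nonzero, so by the cycle condition all
its facet coefficients are nonzero; hence it is the differential of a nonzero
multiple of x^(nu - 1) on [n], which cannot be in I. *)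
Lemma koszul_socle_monomial I nu : (0 < n)%N -> is_monomial_ideal I -> ~ I 1 ->
  koszul_homology_neq0 I n.-1 nu ->
  exists2 m, socle_monomials I m & (m + mnm_one)%MM = nu.
Proof.
move=> n_gt0 monI I1 /existsNP[z /not_implyP[[[modz degz] dz] Nbz]].
have [I0 _ IM] := monomial_ideal_is_ideal monI.
have z0 J : #|J| != n.-1 -> z J = 0 by have [_] := modz J.
have yC := (koszul_diff_eq0 n_gt0 z0).1 dz.
have X0 i : 'X_i != 0 :> R by rewrite -msupp_eq0 msuppX.
have [i0 yi0] : exists i, facet_coef z i != 0.
  apply: contrapT => Ny; apply: Nbz; exists 0.
    by split=> [J|J mu]; rewrite ffunE ?msupp0.
  rewrite koszul_diff0; apply: koszul_chain_eq => // [J _|i].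
    by rewrite ffunE.
  rewrite {1}/facet_coef ffunE mulr0; apply/esym/eqP; apply: contrapT => /negP ?.
  by apply: Ny; exists i.
have y_neq0 i : facet_coef z i != 0.
  apply: contraNneq yi0 => yi; have /eqP := yC i i0.
  by rewrite yi mulr0 eq_sym mulf_eq0 (negPf (X0 _)).
have degy i mu : mu \in msupp (facet_coef z i) -> (mu + mnm_one = nu + U_(i))%MM.
  by rewrite mem_msupp_sign => /degz <-; rewrite -addmA mnm_one_setC1.
have Iy i mu : mu \in msupp (facet_coef z i) -> I 'X_[mu].
  apply: (monomial_idealP _ monI).1; apply: IM.
  by have [] := modz [set~ i]%SET.
have nu_gt0 i : (0 < nu i)%N.
  (* The facet missing another index j contains i, so its multidegree nu is
     positive at i. *)
  have [/existsP[j neq_ji]|/existsPn only_i] := boolP [exists j, j != i].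
    have /degy/mnmP/(_ i) := mlead_supp (y_neq0 j).
    by rewrite !mnmDE mnm_oneE mnm1E (negPf neq_ji) addn1 addn0 => <-.
  (* Here n = 1, no other facet constrains nu, and nu = 0 would put 1 in I. *)
  have mu_y := mlead_supp (y_neq0 i).
  rewrite lt0n; apply/eqP => nui; apply: I1.
  rewrite -mpolyX0; suff <- : mlead (facet_coef z i) = 0%MM by apply: Iy mu_y.
  apply/mnmP => j; have /negPn/eqP-> := only_i j.
  have /mnmP/(_ i) := degy _ _ mu_y.
  by rewrite !mnmDE mnm_oneE mnm1E eqxx nui mnm0E => /addIn.
pose m := (nu - mnm_one)%MM.
have defnu : (m + mnm_one)%MM = nu.
  by apply: submK; apply/mnm_lepP => i; rewrite mnm_oneE.
have suppy i mu : mu \in msupp (facet_coef z i) -> mu = (m + U_(i))%MM.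
  move/degy/mnmP => eq_mu; apply/mnmP => j; apply: (@addIn (mnm_one j)).
  by rewrite -mnmDE eq_mu -defnu !mnmDE addnAC.
exists m => //; split=> [Im|i]; last first.
  have mu_y := mlead_supp (y_neq0 i).
  by rewrite -(suppy _ _ mu_y); apply: Iy mu_y.
(* If x^m were in I, the cycle would bound: all y_i share one scalar, and c x^m
   on [n] is a primitive. *)
pose c i := (facet_coef z i)@_(m + U_(i)).
have yE i : facet_coef z i = c i *: 'X_[m + U_(i)].
  apply/mpolyP => mu; rewrite mcoeffZ mcoeffX.
  case: eqVneq => [<-|neq_mu]; first by rewrite mulr1.
  rewrite mulr0; apply/eqP; rewrite mcoeff_eq0; apply: contraNN neq_mu.
  by move/suppy->.
have cE i j : c i = ('X_j * facet_coef z i)@_(U_(j) + (m + U_(i))).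
  by rewrite mulrC mcoeffMX.
have cC i j : c i = c j.
  rewrite (cE i j) (cE j i) yC; congr (_@__).
  by rewrite addmA [LHS]addmC (addmC m).
pose w : chain := koszul_elt (c i0 *: 'X_[m]) [set: 'I_n]%SET.
have w0 J : #|J| != n.-1.+1 -> w J = 0 by apply: koszul_elt_setT_degree.
apply: Nbz; exists w.
  split=> [J|J mu].
    split=> [|/w0//]; rewrite ffunE; case: eqP => // _.
    by rewrite -mul_mpolyC; apply: IM.
  rewrite ffunE; case: eqP => [->|_]; last by rewrite msupp0.
  by move/msuppZ_le; rewrite msuppX inE => /eqP->.
apply: koszul_chain_eq => // [J /(koszul_diff_degree w0)//|i].
rewrite koszul_diff_top ffunE eqxx yE (cC i i0) -scalerAr; congr (_ *: _).
by rewrite mpolyXD mulrC.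
Qed.

Lemma koszul_multidegrees_socle I : (0 < n)%N -> is_monomial_ideal I -> ~ I 1 ->
  koszul_multidegrees I n.-1 =
  [set (m + mnm_one)%MM | m in socle_monomials I]%classic.
Proof.
move=> n_gt0 monI I1; apply/seteqP; split=> [nu|_ [m soc_m <-]].
  exact: koszul_socle_monomial.
exact: socle_monomial_koszul.
Qed.

End Koszul.

Theorem proposition2p3p5 (k : fieldType) (n : nat) (I : set {mpoly k[n]})
    (char_k : [pchar k]%R =i pred0) (n_gt0 : (0 < n)%N)
    (artinian_I : artinian_monomial_ideal I) :
  is_irredundant_irreducible_decomposition I (koszul_multidegrees I n.-1).
Proof.
have [monI _] := artinian_I; have [N bnd] := artinian_mdeg_bound artinian_I.
rewrite (koszul_multidegrees_socle n_gt0 monI (artinian_one_notin artinian_I)).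
exact: socle_irredundant_decomposition bnd.
Qed.
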